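(* The algebra $\mathcal A^\Gamma=\{f\in\mathcal A:\gamma\cdot f=f\text{ for all }\gamma\in\Gamma\}$ of $\Gamma$-invariants of the graph algebra is monogenic as an abstract $\mathbb C$-algebra: $$\mathcal A^\Gamma=\mathbb C[z]$$ for some $z\in\mathcal A^\Gamma$.
   Context: Let $n$ be the number of vertices, $m=\binom n2$, $[m]=\{1,\dots,m\}$, and identify $[m]$ with the set of $2$-element subsets of $\{1,\dots,n\}$ (edges of $K_n$) via the lexicographic order. Each $\pi\in S_n$ permutes edges by $\{i,j\}\mapsto\{\pi(i),\pi(j)\}$; this gives a homomorphism $\varphi:S_n\to S_m$, whose image $\Gamma=\varphi(S_n)\subseteq S_m$ is the pair group. The graph algebra is $\mathcal A=\mathbb C[x_1,\dots,x_m]/(x_1^2-x_1,\dots,x_m^2-x_m)$, with vector space basis $\boldsymbol{x}_S=\prod_{e\in S}x_e$, $S\subseteq[m]$; $\Gamma$ acts on $\mathcal A$ by algebra automorphisms with $\gamma\cdot\boldsymbol{x}_S=\boldsymbol{x}_{\gamma(S)}$. $\mathbb C[z]$ denotes the unital $\mathbb C$-subalgebra generated by $z$. *)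

(* Defs.v *)
From HB Require Import structures.
From mathcomp Require Import all_boot all_order all_algebra all_fingroup.
From mathcomp Require Import complex boolp reals.
From mathcomp Require Import mpoly.

Set Implicit Arguments.
Unset Strict Implicit.
Unset Printing Implicit Defensive.

Import GRing.Theory.
Local Open Scope ring_scope.
Local Open Scope quotient_scope.

(* The 2-subsets {i, j}, i < j, listed in the lexicographic order of (i, j). *)
Definition edge_seq (n : nat) : seq {set 'I_n} :=
  [seq [set ij.1; ij.2]
     | ij : 'I_n * 'I_n <- [seq (i, j) | i <- enum 'I_n, j <- enum 'I_n]
       & (ij.1 < ij.2)%N].

Lemma mem_edge_seq n (A : {set 'I_n}) : (A \in edge_seq n) = (#|A| == 2).
Proof.
apply/idP/idP => [/mapP[[i j]]|/cards2P[i [j [ij ->]]]].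
  rewrite mem_filter /= => /andP[ij _] ->.
  by apply/cards2P; exists i, j; split=> //; rewrite neq_ltn ij.
apply/mapP.
have mem (k l : 'I_n) :
    (k, l) \in [seq (i, j) | i <- enum 'I_n, j <- enum 'I_n].
  by apply/allpairsP; exists (k, l); rewrite !mem_enum.
move: ij; rewrite neq_ltn => /orP[ij|ji].
  by exists (i, j) => //; rewrite mem_filter /= ij mem.
by exists (j, i); rewrite ?mem_filter /= ?ji ?mem // setUC.
Qed.

Lemma edge_seq_uniq n : uniq (edge_seq n).
Proof.
rewrite map_inj_in_uniq.
  by apply/filter_uniq/allpairs_uniq; rewrite ?enum_uniq // => -[? ?] [].
move=> [i j] [k l]; rewrite !mem_filter /= => /andP[ij _] /andP[kl _] eqA.
have := set22 i j; have := set21 i j; rewrite eqA.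
case/set2P => ik /set2P[] jl; move: ij; rewrite ik jl ?ltnn //.
by rewrite ltnNge (ltnW kl).
Qed.

Lemma size_edge_seq n : size (edge_seq n) = 'C(n, 2).
Proof.
rewrite -[n in RHS]card_ord -card_draws cardE; apply: perm_size.
rewrite uniq_perm ?edge_seq_uniq ?enum_uniq // => A.
by rewrite mem_edge_seq mem_enum inE.
Qed.

(* The identification of 'I_'C(n, 2) with the edges of K_n. *)
Definition edge (n : nat) (e : 'I_'C(n, 2)) : {set 'I_n} :=
  nth set0 (edge_seq n) e.

Lemma edge_inj n : injective (@edge n).
Proof.
move=> e f /eqP; rewrite /edge nth_uniq ?size_edge_seq ?edge_seq_uniq //.
by move/eqP/val_inj.
Qed.

Lemma card_edge n (e : 'I_'C(n, 2)) : #|edge e| = 2.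
Proof.
by apply/eqP; rewrite -mem_edge_seq /edge mem_nth // size_edge_seq.
Qed.

Lemma edge_surj n (A : {set 'I_n}) : #|A| = 2 -> exists e, edge e = A.
Proof.
move/eqP; rewrite -mem_edge_seq => memA.
have lt_m : (index A (edge_seq n) < 'C(n, 2))%N.
  by rewrite -size_edge_seq index_mem.
by exists (Ordinal lt_m); rewrite /edge nth_index.
Qed.

(* The default value e is never used, see edge_permE. *)
Definition edge_perm_fun (n : nat) (p : 'S_n) (e : 'I_'C(n, 2)) : 'I_'C(n, 2) :=
  odflt e [pick f | edge f == p @: edge e].

Lemma edge_perm_funE n (p : 'S_n) e :
  edge (edge_perm_fun p e) = p @: edge e.
Proof.
rewrite /edge_perm_fun; case: pickP => [f /eqP //|/= none].
have [|f fP] := @edge_surj n (p @: edge e).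
  by rewrite card_imset ?card_edge //; apply: perm_inj.
by have := none f; rewrite fP eqxx.
Qed.

Lemma edge_perm_fun_inj n (p : 'S_n) : injective (edge_perm_fun p).
Proof.
move=> e f /(congr1 (@edge n)); rewrite !edge_perm_funE.
by move/(imset_inj (@perm_inj _ p))/edge_inj.
Qed.

Definition edge_perm (n : nat) (p : 'S_n) : 'S_('C(n, 2)) :=
  perm (@edge_perm_fun_inj n p).

Lemma edge_permE n (p : 'S_n) e : edge (edge_perm p e) = p @: edge e.
Proof. by rewrite permE edge_perm_funE. Qed.

Lemma edge_permM n : {in [set: 'S_n] &, {morph @edge_perm n : p q / (p * q)%g}}.
Proof.
move=> p q _ _; apply/permP => e; apply: edge_inj.
rewrite permM !edge_permE -imset_comp; apply: eq_imset => i /=.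
by rewrite permM.
Qed.

Canonical edge_perm_morphism n := Morphism (@edge_permM n).

Definition pair_group (n : nat) : {group 'S_('C(n, 2))} :=
  [group of (@edge_perm n @* [set: 'S_n])%g].

Section GraphAlgebra.

Variables (F : fieldType) (m : nat).

(* The ideal generated by the x_i^2 - x_i; membership is made boolean by
   excluded middle, as required by the quotient construction. *)
Definition graph_ideal : {pred {mpoly F[m]}} :=
  [pred p | `[< exists c : 'I_m -> {mpoly F[m]},
                  p = \sum_i c i * ('X_i ^+ 2 - 'X_i) >]].

Lemma graph_ideal_closed : idealr_closed graph_ideal.
Proof.
split.
- by apply/asboolP; exists (fun=> 0); rewrite big1 // => i _; rewrite mul0r.
- apply/asboolP => -[c /(congr1 (meval (fun=> 0)))]; rewrite meval1 => /eqP.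
  rewrite raddf_sum big1 ?oner_eq0 //= => i _.
  by rewrite mevalM mevalB rmorphXn /= mevalXU expr0n subrr mulr0.
- move=> a p q /asboolP[c ->] /asboolP[d ->]; apply/asboolP.
  exists (fun i => a * c i + d i); rewrite mulr_sumr -big_split.
  by apply: eq_bigr => i _ /=; rewrite mulrDl mulrA.
Qed.

HB.instance Definition _ :=
  isIdealr.Build {mpoly F[m]} graph_ideal graph_ideal_closed.

Definition graph_algebra : Type := {ideal_quot graph_ideal}.

HB.instance Definition _ := GRing.ComNzRing.on graph_algebra.
HB.instance Definition _ := NzRingQuotient.on graph_algebra.

Definition ga_pi (p : {mpoly F[m]}) : graph_algebra := \pi_graph_algebra p.

Lemma ga_pi_is_zmod_morphism : zmod_morphism ga_pi.
Proof. exact: pi_is_zmod_morphism. Qed.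
HB.instance Definition _ :=
  GRing.isZmodMorphism.Build _ _ ga_pi ga_pi_is_zmod_morphism.

Lemma ga_pi_is_monoid_morphism : monoid_morphism ga_pi.
Proof. exact: pi_is_monoid_morphism. Qed.
HB.instance Definition _ :=
  GRing.isMonoidMorphism.Build _ _ ga_pi ga_pi_is_monoid_morphism.

Lemma ga_pi_eq p q : (ga_pi p == ga_pi q) = (p - q \in graph_ideal).
Proof. by rewrite Quotient.idealrBE. Qed.

Lemma ga_reprK (f : graph_algebra) : ga_pi (generic_quotient.repr f) = f.
Proof. exact: reprK. Qed.

Definition ga_scale (c : F) (f : graph_algebra) : graph_algebra :=
  ga_pi c%:MP * f.

Lemma ga_scaleA c d f : ga_scale c (ga_scale d f) = ga_scale (c * d) f.
Proof. by rewrite /ga_scale mulrA -rmorphM -mpolyCM. Qed.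

Lemma ga_scale1 : left_id 1 ga_scale.
Proof. by move=> f; rewrite /ga_scale mpolyC1 rmorph1 mul1r. Qed.

Lemma ga_scaleDr : right_distributive ga_scale +%R.
Proof. by move=> c f g; rewrite /ga_scale mulrDr. Qed.

Lemma ga_scaleDl f : {morph ga_scale^~ f : c d / c + d}.
Proof. by move=> c d; rewrite /ga_scale mpolyCD rmorphD mulrDl. Qed.

HB.instance Definition _ := GRing.Zmodule_isLmodule.Build F graph_algebra
  ga_scaleA ga_scale1 ga_scaleDr ga_scaleDl.

Lemma ga_scaleAl (c : F) (f g : graph_algebra) : c *: (f * g) = c *: f * g.
Proof. exact: mulrA. Qed.

HB.instance Definition _ :=
  GRing.Lmodule_isLalgebra.Build F graph_algebra ga_scaleAl.

Lemma ga_scaleAr (c : F) (f g : graph_algebra) : c *: (f * g) = f * (c *: g).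
Proof. exact: mulrCA. Qed.

HB.instance Definition _ :=
  GRing.Lalgebra_isAlgebra.Build F graph_algebra ga_scaleAr.

Lemma ga_piZ (c : F) p : ga_pi (c *: p) = c *: ga_pi p.
Proof. by rewrite -mul_mpolyC rmorphM. Qed.

Definition ga_monomial (S : {set 'I_m}) : graph_algebra :=
  \prod_(e in S) ga_pi 'X_e.

(* msym g substitutes 'X_(g i) for 'X_i; ga_act_pi shows independence of the
   chosen representative. *)
Definition ga_act (g : 'S_m) (f : graph_algebra) : graph_algebra :=
  ga_pi (msym g (generic_quotient.repr f)).

Lemma msym_graph_ideal (g : 'S_m) p :
  p \in graph_ideal -> msym g p \in graph_ideal.
Proof.
case/asboolP => c ->; apply/asboolP.
exists (fun i => msym g (c ((g^-1)%g i))).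
rewrite raddf_sum [RHS](reindex_inj (@perm_inj _ g)) /=; apply: eq_bigr => i _.
rewrite msymM permK; congr (_ * _).
by rewrite raddfB /= rmorphXn /= /msym mmapX mmap1U.
Qed.

Lemma ga_act_pi g p : ga_act g (ga_pi p) = ga_pi (msym g p).
Proof.
apply/eqP; rewrite ga_pi_eq -raddfB; apply: msym_graph_ideal.
by rewrite -ga_pi_eq ga_reprK.
Qed.

Lemma ga_act_is_linear g : linear (ga_act g).
Proof.
move=> c f h; rewrite -[f]ga_reprK -[h]ga_reprK -ga_piZ -rmorphD !ga_act_pi.
by rewrite raddfD /= msymZ raddfD /= ga_piZ.
Qed.
HB.instance Definition _ g :=
  GRing.isLinear.Build F graph_algebra graph_algebra *:%R (ga_act g)
    (ga_act_is_linear g).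

Lemma ga_act_is_monoid_morphism g : monoid_morphism (ga_act g).
Proof.
split=> [|f h]; first by rewrite -[1](rmorph1 ga_pi) ga_act_pi msym1.
rewrite -[f]ga_reprK -[h]ga_reprK -rmorphM !ga_act_pi.
by rewrite msymM rmorphM.
Qed.
HB.instance Definition _ g :=
  GRing.isMonoidMorphism.Build graph_algebra graph_algebra (ga_act g)
    (ga_act_is_monoid_morphism g).

Lemma ga_act_monomial (g : 'S_m) (S : {set 'I_m}) :
  ga_act g (ga_monomial S) = ga_monomial (g @: S).
Proof.
rewrite /ga_monomial rmorph_prod big_imset /=; last first.
  by move=> ? ? _ _; apply: perm_inj.
by apply: eq_bigr => e _; rewrite ga_act_pi /msym mmapX mmap1U.
Qed.

(* With MathComp's product of permutations, (g * h) x = h (g x). *)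
Lemma ga_actM (g h : 'S_m) f : ga_act (g * h)%g f = ga_act h (ga_act g f).
Proof. by rewrite -[f]ga_reprK !ga_act_pi msymMm. Qed.

End GraphAlgebra.

Definition pair_invariants (F : fieldType) (n : nat) :
    {pred graph_algebra F 'C(n, 2)} :=
  [pred f | [forall g in pair_group n, ga_act g f == f]].
Arguments pair_invariants : clear implicits.

(* The unital subalgebra generated by z, as the smallest one containing z. *)
Definition generated_subalgebra (F : fieldType) (A : algType F) (z : A) :
    {pred A} :=
  [pred f | `[< forall S : {pred A},
                  GRing.subalg_closed S -> z \in S -> f \in S >]].

(* Main.v *)
Require Import Defs.
From mathcomp Require Import all_boot all_algebra complex reals.
From HB Require Import structures.
From mathcomp Require Import all_fingroup boolp mpoly qpoly.

Set Implicit Arguments.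
Unset Strict Implicit.
Unset Printing Implicit Defensive.

Import GRing.Theory Num.Theory.
Local Open Scope ring_scope.

(** The graph algebra is the coordinate ring of the cube {0,1}^m: its elements
    are exactly the functions on subsets T of 'I_m, a polynomial being evaluated
    at the indicator vector of T ([point_eval_inj] and [point_eval_surj]).  The
    proof uses the idempotents
      delta_T = \prod_(i in T) x_i * \prod_(i notin T) (1 - x_i).
    They sum to 1, by expanding \prod_i (x_i + (1 - x_i)), and f delta_T is
    f(T) delta_T because x_i ^ 2 = x_i; hence f is the sum of the
    f(T) delta_T.

    A permutation g sends delta_T to delta_(g T), so under this identification
    it moves the function f along T |-> g T, and the invariants of a permutation
    group G are the functions that are constant on the G-orbits of subsets
    ([ga_act_fixedP]).

    Such an algebra of functions on a finite set of orbits is generated by any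
    function z that separates the orbits: given an invariant f, Lagrange
    interpolation provides a polynomial q taking the value f(T) at z(T) for
    every T, and then f = q(z).  A separating z exists in characteristic 0:
    number the orbits through a chosen representative of each.
    The argument applies to every permutation group
    ([group_invariants_monogenic]), in particular to the pair group. *)

(** * Interpolation and generated subalgebras *)

Lemma interpolation (F : numFieldType) (k : nat) (v : 'I_k -> F) :
  exists q : {poly F}, forall i : 'I_k, q.[i%:R] = v i.
Proof.
case: k => [|k] in v *; first by exists 0 => -[].
pose x (i : nat) : F := i%:R.
have x_inj : injective x by move=> i j /eqP; rewrite /x eqr_nat => /eqP.
exists (\sum_i v i *: val (tnth (lagrange k.+1 x) i)) => i.
have sample j : (val (tnth (lagrange k.+1 x) j)).[i%:R] = (j == i)%:R.
  exact: lagrange_sample.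
rewrite horner_sum (bigD1 i) //= big1 => [|j /negPf ji].
  by rewrite hornerZ sample eqxx mulr1 addr0.
by rewrite hornerZ sample ji mulr0.
Qed.

Lemma horner_alg_generated (F : fieldType) (A : algType F) (z : A)
    (q : {poly F}) :
  horner_alg z q \in generated_subalgebra z.
Proof.
apply/asboolP => S [S1 Slin SM] Sz.
elim/poly_ind: q => [|q c Sq].
  by rewrite rmorph0 -(subrr 1) addrC -scaleN1r Slin.
rewrite rmorphD rmorphM /= horner_algX horner_algC addrC.
by apply: Slin => //; apply: SM.
Qed.

(** * The graph algebra as an algebra of functions on sets of edges *)

Section PointEvaluation.

Variables (F : fieldType) (m : nat).
Implicit Types (T U : {set 'I_m}) (f : graph_algebra F m) (g : 'S_m).

Definition set_point T (i : 'I_m) : F := (i \in T)%:R.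

Definition point_eval T f : F := (generic_quotient.repr f).@[set_point T].

(** Evaluation descends to the quotient, as x_i ^ 2 - x_i vanishes at 0 and
    at 1. *)
Lemma point_eval_pi T p : point_eval T (ga_pi p) = p.@[set_point T].
Proof.
apply/eqP; rewrite -subr_eq0 -mevalB.
have : generic_quotient.repr (ga_pi p) - p \in @graph_ideal F m.
  by rewrite -ga_pi_eq ga_reprK.
case/asboolP => c ->; rewrite raddf_sum big1 //= => i _.
rewrite mevalM mevalB rmorphXn /= mevalXU /set_point.
by case: (i \in T); rewrite ?expr1n ?expr0n subrr mulr0.
Qed.

Lemma point_eval_is_linear T : linear_for *%R (point_eval T).
Proof.
move=> c f h; rewrite -[f]ga_reprK -[h]ga_reprK -ga_piZ -rmorphD.
by rewrite !point_eval_pi mevalD mevalZ.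
Qed.
HB.instance Definition _ T :=
  GRing.isLinear.Build F (graph_algebra F m) F *%R (point_eval T)
    (point_eval_is_linear T).

Lemma point_eval_is_monoid_morphism T : monoid_morphism (point_eval T).
Proof.
split=> [|f h]; first by rewrite -[1](rmorph1 (@ga_pi F m)) point_eval_pi meval1.
rewrite -[f]ga_reprK -[h]ga_reprK -rmorphM !point_eval_pi; exact: mevalM.
Qed.
HB.instance Definition _ T :=
  GRing.isMonoidMorphism.Build (graph_algebra F m) F (point_eval T)
    (point_eval_is_monoid_morphism T).

Definition ga_delta T : graph_algebra F m :=
  \prod_i (if i \in T then ga_pi 'X_i else 1 - ga_pi 'X_i).

Lemma ga_X_idem i : ga_pi 'X_i * ga_pi 'X_i = ga_pi 'X_i :> graph_algebra F m.
Proof.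
rewrite -rmorphM; apply/eqP; rewrite ga_pi_eq; apply/asboolP.
exists (fun j => (j == i)%:R); rewrite (bigD1 i) //= big1 => [|j /negPf ->].
  by rewrite eqxx mul1r addr0 expr2.
by rewrite mul0r.
Qed.

Lemma ga_X_delta i T : ga_pi 'X_i * ga_delta T = set_point T i *: ga_delta T.
Proof.
rewrite /ga_delta (bigD1 i) //= mulrA /set_point; case: (i \in T).
  by rewrite ga_X_idem scale1r.
by rewrite mulrBr mulr1 ga_X_idem subrr mul0r scale0r.
Qed.

(** The line spanned by [ga_delta T] is an ideal on which each generator x_i,
    being idempotent, acts by the scalar 0 or 1 ([ga_X_delta]); so every
    polynomial acts on it by its value at T. *)
Lemma mul_ga_delta f T : f * ga_delta T = point_eval T f *: ga_delta T.
Proof.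
rewrite -[f]ga_reprK point_eval_pi; move: (generic_quotient.repr f) => p.
elim/mpolyind: p => [|c u p _ _ IHp]; first by rewrite !raddf0 mul0r scale0r.
rewrite rmorphD /= ga_piZ mevalD mevalZ mulrDl scalerDl IHp; congr (_ + _).
rewrite -scalerAl -scalerA; congr (_ *: _).
rewrite mevalX mpolyXE_id rmorph_prod.
apply: (big_ind2 (fun h (a : F) => h * ga_delta T = a *: ga_delta T)).
- by rewrite mul1r scale1r.
- by move=> h a h' a' e e'; rewrite -mulrA e' -scalerAr e scalerA mulrC.
move=> i _; elim: (u i) => [|k IHk]; first by rewrite !expr0 rmorph1 mul1r scale1r.
by rewrite !exprS rmorphM -mulrA IHk -scalerAr ga_X_delta scalerA mulrC.
Qed.

Lemma sum_ga_delta : \sum_(T : {set 'I_m}) ga_delta T = 1.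
Proof.
transitivity (\prod_(i < m) (ga_pi 'X_i + (1 - ga_pi 'X_i)) : graph_algebra F m).
  by rewrite bigA_distr.
by rewrite big1 // => i _; rewrite addrCA subrr addr0.
Qed.

Lemma ga_delta_expansion f : f = \sum_T point_eval T f *: ga_delta T.
Proof.
rewrite -[LHS]mulr1 -sum_ga_delta mulr_sumr.
by apply: eq_bigr => T _; rewrite mul_ga_delta.
Qed.

(** This is the Nullstellensatz for the cube: a polynomial that vanishes at all
    0-1 points lies in the ideal of the x_i ^ 2 - x_i. *)
Lemma point_eval_inj f h : point_eval^~ f =1 point_eval^~ h -> f = h.
Proof.
move=> efh; rewrite [f]ga_delta_expansion [h]ga_delta_expansion.
by apply: eq_bigr => T _; rewrite efh.
Qed.

Lemma point_eval_delta T U : point_eval T (ga_delta U) = (T == U)%:R.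
Proof.
have factorE i : point_eval T (if i \in U then ga_pi 'X_i else 1 - ga_pi 'X_i)
    = ((i \in T) == (i \in U))%:R.
  case: (i \in U); rewrite ?raddfB /= ?rmorph1 point_eval_pi mevalXU /set_point.
    by rewrite eqb_id.
  by rewrite eqbF_neg; case: (i \in T); rewrite ?subrr ?subr0.
rewrite rmorph_prod (eq_bigr _ (fun i _ => factorE i)).
case: eqVneq => [->|neqTU]; first by rewrite big1 // => i _; rewrite eqxx.
have [i neqi] : exists i, (i \in T) != (i \in U).
  apply/existsP; apply: contraNT neqTU; rewrite negb_exists => /forallP eqTU.
  by apply/eqP/setP => i; apply/eqP; have := eqTU i; rewrite negbK.
by rewrite (bigD1 i) //= (negPf neqi) mul0r.
Qed.

Lemma point_eval_surj (c : {set 'I_m} -> F) :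
  exists f, point_eval^~ f =1 c.
Proof.
exists (\sum_U c U *: ga_delta U) => T.
rewrite raddf_sum (bigD1 T) //= big1 => [|U neqUT].
  by rewrite linearZ /= point_eval_delta eqxx mulr1 addr0.
by rewrite linearZ /= point_eval_delta eq_sym (negPf neqUT) mulr0.
Qed.

Lemma point_eval_horner T f (q : {poly F}) :
  point_eval T (horner_alg f q) = q.[point_eval T f].
Proof.
elim/poly_ind: q => [|q c IHq]; first by rewrite !raddf0 horner0.
rewrite rmorphD rmorphM /= horner_algX horner_algC hornerMXaddC.
by rewrite raddfD /= linearZ rmorph1 /= mulr1 rmorphM /= IHq.
Qed.

Lemma ga_act_delta g T : ga_act g (ga_delta T) = ga_delta (g @: T).
Proof.
rewrite rmorph_prod [RHS](reindex_inj (@perm_inj _ g)) /=.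
apply: eq_bigr => i _; rewrite mem_imset; last exact: perm_inj.
by case: (i \in T); rewrite ?raddfB /= ?rmorph1 ga_act_pi /msym mmapX mmap1U.
Qed.

(** Obtained by applying g to [f * ga_delta T = point_eval T f *: ga_delta T]
    and evaluating at [g @: T], where the image of [ga_delta T] takes the
    value 1. *)
Lemma point_eval_act g T f :
  point_eval (g @: T) (ga_act g f) = point_eval T f.
Proof.
have := congr1 (fun h => point_eval (g @: T) (ga_act g h)) (mul_ga_delta f T).
rewrite /= linearZ /= rmorphM /= ga_act_delta rmorphM linearZ /=.
by rewrite point_eval_delta eqxx !mulr1.
Qed.

Lemma ga_act_fixedP g f :
  ga_act g f = f <-> forall T, point_eval (g @: T) f = point_eval T f.
Proof.
split=> [gf T|gf]; first by rewrite -{1}gf point_eval_act.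
apply: point_eval_inj => T; have -> : T = g @: (g @^-1: T).
  apply/setP => i; rewrite -(permKV g i) mem_imset ?inE //; exact: perm_inj.
by rewrite point_eval_act gf.
Qed.

End PointEvaluation.

(** * Invariants of a permutation group *)

Section Invariants.

Variables (F : numFieldType) (m : nat) (G : {group 'S_m}).

(** The instance [G := pair_group n] is convertible to [pair_invariants]. *)
Definition group_invariants : {pred graph_algebra F m} :=
  [pred f | [forall g in G, ga_act g f == f]].

Lemma group_invariantsP f :
  reflect (forall g, g \in G -> ga_act g f = f) (f \in group_invariants).
Proof. by apply: (iffP forall_inP) => Gf g /Gf /eqP. Qed.

Lemma group_invariants_subalg : GRing.subalg_closed group_invariants.
Proof.
split=> [|c f h /group_invariantsP Gf /group_invariantsP Gh|
          f h /group_invariantsP Gf /group_invariantsP Gh];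
    apply/group_invariantsP => g Gg.
- exact: rmorph1.
- by rewrite linearP /= Gf ?Gh.
- by rewrite rmorphM /= Gf ?Gh.
Qed.

(** A choice of one set in each orbit, so that the numbering of all subsets of
    'I_m also numbers the orbits. *)
Lemma orbit_representative :
  exists r : {set 'I_m} -> {set 'I_m},
    (forall T, exists2 g, g \in G & r T = g @: T) /\
    (forall g (T : {set _}), g \in G -> r (g @: T) = r T).
Proof.
have actE g (T : {set 'I_m}) : ('P^*)%act T g = g @: T by apply: setactE.
pose O := orbit ('P^*)%act G.
exists (fun T => choose (mem (O T)) T); split=> [T|g T Gg].
  have /orbitP[g Gg <-] : choose (mem (O T)) T \in O T.
    by apply: (@chooseP _ (mem (O T))); apply: orbit_refl.
  by exists g; rewrite ?actE.
(* [choose] depends only on the orbit, not on the member it starts from. *)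
have OgT : O (g @: T) = O T by rewrite -actE /O orbit_act.
rewrite OgT; apply: choose_id; last exact: orbit_refl.
by rewrite -OgT; exact: orbit_refl.
Qed.

Theorem group_invariants_monogenic :
  exists2 z, z \in group_invariants &
    group_invariants =i generated_subalgebra z.
Proof.
have [r [rP rG]] := orbit_representative.
(* z takes at T the number of the representative of the orbit of T. *)
have [z zE] := point_eval_surj (fun T => (enum_rank (r T))%:R : F).
have Gz : z \in group_invariants.
  by apply/group_invariantsP => g Gg; apply/ga_act_fixedP => T; rewrite !zE rG.
exists z => // f; apply/idP/idP => [/group_invariantsP Gf|/asboolP Zf]; last first.
  exact: Zf group_invariants_subalg Gz.
pose v (i : 'I_#|{: {set 'I_m}}|) := point_eval (enum_val i) f.
have [q qE] := interpolation v.
suff -> : f = horner_alg z q by apply: horner_alg_generated.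
apply: point_eval_inj => T; rewrite point_eval_horner zE qE /v enum_rankK.
by have [g Gg ->] := rP T; have /ga_act_fixedP -> := Gf g Gg.
Qed.

End Invariants.

Theorem theorem4p5 (R : realType) (n : nat) :
  exists2 z : graph_algebra R[i] 'C(n, 2),
    z \in pair_invariants R[i] n &
    pair_invariants R[i] n =i generated_subalgebra z.
Proof. exact: (@group_invariants_monogenic R[i] _ (pair_group n)). Qed.
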